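(* Let $N \ge 1$, let $G_N$ be the divisibility graph on $X_N=\{1,\dots,N\}$, and let $n \in X_N$. Let $s(m)$ denote the number of positive divisors of $m$ (including $1$ and $m$), and put $M(n)=\left\lfloor \frac{N}{n}\right\rfloor$. Let $e_n$ be the number of unordered pairs $\{i,j\}$ of distinct neighbours of $n$ in $G_N$ such that $i$ and $j$ are adjacent. Then $$e_n = \sum_{m \mid n} s(m) - 2s(n) + 1 + \sum_{j=2}^{M(n)} \left\lfloor \frac{M(n)}{j} \right\rfloor + (M(n)-1)\,(s(n)-2),$$ where the first sum runs over the positive divisors $m$ of $n$.
   Context: The divisibility graph $G_N$ is the simple undirected graph with vertex set $X_N=\{1,\dots,N\}$, in which two distinct vertices $i \ne j$ are adjacent if and only if $i$ divides $j$ or $j$ divides $i$ (no loops). Two vertices are neighbours if they are adjacent. $\lfloor x \rfloor$ denotes the floor of $x$; an empty sum is $0$. *)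

(* Defs.v *)
From HB Require Import structures.
From mathcomp Require Import all_boot all_order all_algebra.
Set Implicit Arguments.
Unset Strict Implicit.
Unset Printing Implicit Defensive.

Definition vertex (N : nat) : Type := {i : 'I_N.+1 | (0 < i)%N}.
HB.instance Definition _ (N : nat) := Finite.on (vertex N).

Definition label (N : nat) (i : vertex N) : nat := val (val i).

Definition divadj (N : nat) : rel (vertex N) :=
  fun i j => (i != j) && ((label i %| label j)%N || (label j %| label i)%N).

Definition neighbours (N : nat) (n : vertex N) : {set vertex N} :=
  [set i | divadj n i].

(* Unordered pairs of distinct vertices are encoded as the two-element sets
   [set i; j] with i != j. *)
Definition neighbour_edges (N : nat) (n : vertex N) : {set {set vertex N}} :=
  [set A : {set vertex N} |
    [exists i in neighbours n, exists j in neighbours n,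
      [&& i != j, divadj i j & A == [set i; j]]]].

Definition num_divisors (m : nat) : nat := size (divisors m).

(* Main.v *)
(* Every edge between two neighbours of [n] is counted once as an ordered pair
   [(i, j)] with [i] a proper divisor of [j].  The neighbours of [n] are its
   proper divisors and its multiples [k * n] with [2 <= k <= M].  Pairs of proper
   divisors contribute [s m - 1] for each proper divisor [m] of [n], pairs of
   multiples contribute [M %/ k - 1] for each [k], and each of the
   [(s n - 1) * (M - 1)] mixed pairs is an edge. *)
Require Import Defs.
From HB Require Import structures.
From mathcomp Require Import all_boot all_order all_algebra.
From mathcomp Require Import zify.
Set Implicit Arguments.
Unset Strict Implicit.
Unset Printing Implicit Defensive.
Import GRing.Theory.
Local Open Scope ring_scope.

Section Counting.
Local Open Scope nat_scope.

Definition proper_dvd (i j : nat) : bool := (i != j) && (i %| j).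

Definition proper_divisors (n : nat) : seq nat :=
  [seq d <- divisors n | d != n].

Definition proper_multiples (N n : nat) : seq nat :=
  [seq k * n | k <- index_iota 2 (N %/ n).+1].

Lemma label_inj (N : nat) : injective (@label N).
Proof. by move=> i j eq_ij; do 2!apply: val_inj. Qed.

Lemma label_gt0 (N : nat) (i : vertex N) : 0 < label i.
Proof. exact: (valP i). Qed.

Lemma label_le (N : nat) (i : vertex N) : label i <= N.
Proof. by rewrite -ltnS; apply: ltn_ord. Qed.

Lemma label_surj (N m : nat) :
  0 < m -> m <= N -> exists i : vertex N, label i = m.
Proof.
move=> m_gt0 le_mN.
have lt_m : m < N.+1 by rewrite ltnS.
by exists (exist (fun i : 'I_N.+1 => is_true (0 < i)) (Ordinal lt_m) m_gt0).
Qed.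

Lemma proper_dvd_lt (i j : nat) : 0 < j -> proper_dvd i j -> i < j.
Proof. by move=> j_gt0 /andP[ne_ij /dvdn_leq le_ij]; rewrite ltn_neqAle ne_ij le_ij. Qed.

Lemma mem_proper_divisors (n d : nat) :
  0 < n -> (d \in proper_divisors n) = proper_dvd d n.
Proof. by move=> n_gt0; rewrite mem_filter -dvdn_divisors. Qed.

Lemma proper_dvd_pmul2r (n i j : nat) :
  0 < n -> proper_dvd (i * n) (j * n) = proper_dvd i j.
Proof. by move=> n_gt0; rewrite /proper_dvd eqn_pmul2r ?dvdn_pmul2r. Qed.

Lemma sum_nat_of_bool (I : Type) (r : seq I) (a : pred I) :
  \sum_(i <- r) a i = count a r.
Proof. by rewrite -sum1_count [RHS]big_mkcond; apply: eq_bigr => i _; case: (a i). Qed.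

(** Both lists are duplicate-free, so it suffices to compare their members. This lets sums over
    neighbours become sums over natural numbers. *)
Lemma neighbour_labels (N : nat) (n : vertex N) :
  perm_eq [seq label i | i <- enum (neighbours n)]
    (proper_divisors (label n) ++ proper_multiples N (label n)).
Proof.
have n_gt0 := label_gt0 n.
apply: uniq_perm.
- by rewrite map_inj_uniq ?enum_uniq //; apply: label_inj.
- rewrite cat_uniq filter_uniq ?divisors_uniq //=.
  rewrite map_inj_uniq ?iota_uniq ?andbT; last first.
    by move=> k l /eqP; rewrite eqn_pmul2r // => /eqP.
  (* The two lists are disjoint: a proper divisor lies below [label n], a multiple with [k >= 2]
     above it. *)
  apply/hasPn => _ /mapP[k + ->]; rewrite mem_index_iota => /andP[k_ge2 _].
  rewrite mem_proper_divisors //; apply/negP => /(proper_dvd_lt n_gt0).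
  nia.
move=> m; rewrite mem_cat mem_proper_divisors //.
apply/mapP/orP => [[i]|].
  rewrite mem_enum inE /divadj => /andP[ne_ni dvd_ni] ->.
  have {}ne_ni : label n != label i.
    by apply: contra_neq ne_ni => /label_inj.
  case/orP: dvd_ni => [/dvdnP[k def_i]|dvd_in]; [right|left].
    apply/mapP; exists k => //; rewrite mem_index_iota ltnS leq_divRL // -def_i label_le andbT.
    (* [k = 0] contradicts the positivity of labels, and [k = 1] contradicts
       [label n != label i]. *)
    by have := label_gt0 i; rewrite def_i; case: k def_i ne_ni => [|[|k]] // ->; rewrite mul1n eqxx.
  by rewrite /proper_dvd eq_sym ne_ni.
case=> [|/mapP[k + ->]].
  move=> pd; have lt_mn := proper_dvd_lt n_gt0 pd; case/andP: pd => ne_mn dvd_mn.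
  have [i def_m] := label_surj (dvdn_gt0 n_gt0 dvd_mn) (leq_trans (ltnW lt_mn) (label_le n)).
  exists i => //; rewrite mem_enum inE /divadj def_m dvd_mn orbT andbT.
  by apply: contra_neq ne_mn => ->.
rewrite mem_index_iota ltnS leq_divRL // => /andP[k_ge2 le_kN].
have [|i def_i] := label_surj _ le_kN; first by nia.
exists i => //; rewrite mem_enum inE /divadj def_i dvdn_mull // andbT.
by apply/eqP => eq_ni; rewrite -eq_ni in def_i; nia.
Qed.

(** Proper divisibility strictly increases positive labels, so each edge has exactly one
    orientation; hence [(i, j) |-> [set i; j]] is injective on the oriented pairs [P]. *)
Lemma card_neighbour_edges (N : nat) (n : vertex N) :
  #|neighbour_edges n| =
  \sum_(i in neighbours n) \sum_(j in neighbours n) proper_dvd (label i) (label j).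
Proof.
pose P := [set p : vertex N * vertex N |
  [&& p.1 \in neighbours n, p.2 \in neighbours n & proper_dvd (label p.1) (label p.2)]].
have -> : neighbour_edges n = [set [set p.1; p.2] | p in P].
  apply/setP => A; rewrite inE; apply/exists_inP/imsetP.
    case=> i ni /exists_inP[j nj /and3P[ne_ij /andP[_ dvd_ij] /eqP ->]].
    have ne_l : label i != label j by apply: contra_neq ne_ij => /label_inj.
    case/orP: dvd_ij => dvd_ij; [exists (i, j) | exists (j, i)] => //=.
    - by rewrite inE ni nj /proper_dvd ne_l.
    - by rewrite inE ni nj /proper_dvd eq_sym ne_l.
    - by rewrite setUC.
  case=> [[i j]] /=; rewrite inE /= => /and3P[ni nj /andP[ne_l dvd_ij]] ->.
  have ne_ij : i != j by apply: contra_neq ne_l => ->.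
  by exists i => //; apply/exists_inP; exists j; rewrite // /divadj ne_ij dvd_ij eqxx.
rewrite card_in_imset.
  rewrite -sum1_card pair_big_dep big_mkcond [RHS]big_mkcond /=.
  apply: eq_bigr => -[i j] _; rewrite inE /=.
  by case: (i \in _); case: (j \in _); case: proper_dvd.
move=> [i j] [i' j'] /=; rewrite !inE /= => /and3P[_ _ pd] /and3P[_ _ pd'] eq_set.
have lt_ij := proper_dvd_lt (label_gt0 j) pd.
have lt_ij' := proper_dvd_lt (label_gt0 j') pd'.
have /set2P mem_i : i \in [set i'; j'] by rewrite -eq_set set21.
have /set2P mem_j : j \in [set i'; j'] by rewrite -eq_set set22.
(* The swapped and degenerate matchings of [i, j] with [i', j'] contradict the strict inequalities
   between labels. *)
by case: mem_i mem_j => -> [] -> // in lt_ij *; lia.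
Qed.

Lemma sum_neighbours (N : nat) (n : vertex N) (F : nat -> nat) :
  \sum_(i in neighbours n) F (label i) =
  \sum_(d <- proper_divisors (label n)) F d
  + \sum_(2 <= k < (N %/ label n).+1) F (k * label n).
Proof.
rewrite -big_enum /= -(big_map (@label N) predT F).
by rewrite (perm_big _ (neighbour_labels n)) big_cat big_map.
Qed.

Lemma sum_divisors (n : nat) (F : nat -> nat) : 0 < n ->
  \sum_(d <- divisors n) F d = F n + \sum_(d <- proper_divisors n) F d.
Proof.
by move=> n_gt0; rewrite big_filter (bigD1_seq n) ?divisors_uniq ?divisors_id.
Qed.

Lemma num_divisorsE (n : nat) :
  0 < n -> num_divisors n = (size (proper_divisors n)).+1.
Proof.
by move=> n_gt0; rewrite -add1n -!sum1_size -(sum_divisors (fun=> 1)) // sum1_size.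
Qed.

(** By transitivity every proper divisor of [j] is already a proper divisor of [n]. *)
Lemma sum_proper_dvd_divisors (n j : nat) : 0 < n -> j %| n ->
  \sum_(i <- proper_divisors n) proper_dvd i j = size (proper_divisors j).
Proof.
move=> n_gt0 dvd_jn; have j_gt0 := dvdn_gt0 n_gt0 dvd_jn.
rewrite sum_nat_of_bool -size_filter.
apply/perm_size/uniq_perm; rewrite ?filter_uniq ?divisors_uniq //.
move=> i; rewrite mem_filter !mem_proper_divisors //.
apply: andb_idr => pd; have lt_ij := proper_dvd_lt j_gt0 pd; case/andP: pd => _ dvd_ij.
rewrite /proper_dvd (dvdn_trans dvd_ij dvd_jn) andbT.
by rewrite neq_ltn (leq_trans lt_ij) // dvdn_leq.
Qed.

(** [M %/ k] counts the multiples of [k] in [1..M]. Since [k > 1], the number 1 is not among them;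
    the successor accounts for [k] itself. *)
Lemma sum_proper_dvd_multiples (M k : nat) : 1 < k -> k <= M ->
  (\sum_(2 <= l < M.+1) proper_dvd k l).+1 = M %/ k.
Proof.
move=> k_gt1 le_kM; rewrite divn_count_dvd [RHS]big_ltn; last by lia.
have -> : (k %| 1) = false by rewrite dvdn1; apply/eqP; lia.
rewrite [in RHS](eq_bigr (fun l => (l == k) + proper_dvd k l)) => [|l _].
  rewrite big_split /= add0n [X in X + _]sum_nat_of_bool.
  rewrite -[X in X + _]/(count_mem k (index_iota 2 M.+1)) count_uniq_mem ?iota_uniq //.
  by rewrite mem_index_iota k_gt1 ltnS le_kM.
by rewrite /proper_dvd eq_sym; case: eqVneq => [->|_]; rewrite ?dvdnn.
Qed.

End Counting.

(** Adding [M.-1] on the left avoids truncated subtraction: it restores the 1 missing from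
    [M %/ k - 1] for each of the [M.-1] values of [k]. *)
Lemma card_neighbour_edges_split (N : nat) (n : vertex N) :
  let M := (N %/ label n)%N in
  let D := proper_divisors (label n) in
  (#|neighbour_edges n| + M.-1 =
    \sum_(d <- D) size (proper_divisors d) + size D * M.-1
    + \sum_(2 <= k < M.+1) M %/ k)%N.
Proof.
move=> M D; have n_gt0 := label_gt0 n.
rewrite card_neighbour_edges.
under eq_bigr => i _ do rewrite (sum_neighbours n (fun j => proper_dvd (label i) j : nat)).
rewrite (sum_neighbours n (fun i => \sum_(j <- _) proper_dvd i j + \sum_(2 <= k < _) proper_dvd i (k * label n)))%N.
(* Four blocks result; in the divisor-divisor block the larger endpoint becomes the outer index. *)
rewrite -/M -/D !big_split /= exchange_big /=.
have -> : (\sum_(j <- D) \sum_(i <- D) proper_dvd i j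
           = \sum_(d <- D) size (proper_divisors d))%N.
  apply: eq_big_seq => j; rewrite mem_proper_divisors // => /andP[_ dvd_jn].
  exact: sum_proper_dvd_divisors.
have -> : (\sum_(i <- D) \sum_(2 <= k < M.+1) proper_dvd i (k * label n)
           = size D * M.-1)%N.
  have -> : M.-1 = \sum_(2 <= k < M.+1) 1%N by rewrite sum_nat_const_nat; lia.
  rewrite -sum1_size big_distrl; apply: eq_big_seq => i /=.
  rewrite mem_proper_divisors // mul1n => pd; apply: eq_big_nat => k /andP[k_ge2 _].
  have lt_in := proper_dvd_lt n_gt0 pd; case/andP: pd => _ dvd_in.
  by rewrite /proper_dvd dvdn_mull // andbT; case: eqP => //; nia.
(* A multiple of [label n] exceeds every proper divisor, so it divides none of them. *)
have -> : (\sum_(2 <= k < M.+1) \sum_(j <- D) proper_dvd (k * label n) j = 0)%N.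
  rewrite big_nat big1 // => k /andP[k_ge2 _]; rewrite big_seq big1 // => j.
  rewrite mem_proper_divisors // => pd; have lt_jn := proper_dvd_lt n_gt0 pd.
  apply/eqP; rewrite eqb0; apply/negP => /proper_dvd_lt lt_knj.
  by have := lt_knj (dvdn_gt0 n_gt0 (proj2 (andP pd))); nia.
rewrite add0n -addnA; congr addn.
have -> : M.-1 = \sum_(2 <= k < M.+1) 1%N by rewrite sum_nat_const_nat; lia.
rewrite -big_split; apply: eq_big_nat => k /andP[k_ge2 le_kM] /=.
under eq_bigr => l _ do rewrite proper_dvd_pmul2r //.
by rewrite addn1 sum_proper_dvd_multiples.
Qed.

Theorem theorem2 (N : nat) (hN : (1 <= N)%N) (n : vertex N) :
  let s := num_divisors in
  let M := (N %/ label n)%N in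
  (#|neighbour_edges n|)%:Z =
    \sum_(m <- divisors (label n)) (s m)%:Z - 2 * (s (label n))%:Z + 1
    + \sum_(2 <= j < M.+1) (M %/ j)%N%:Z
    + (M%:Z - 1) * ((s (label n))%:Z - 2).
Proof.
move=> s M; have n_gt0 := label_gt0 n.
(* Positivity makes [M.-1] agree with the integer [M - 1]. *)
have M_gt0 : (0 < M)%N by rewrite divn_gt0 // label_le.
have := card_neighbour_edges_split n; rewrite -/M /=.
rewrite -!(big_morph Posz PoszD (erefl _)) sum_divisors //.
set D := proper_divisors (label n).
have -> : (\sum_(d <- D) s d = \sum_(d <- D) size (proper_divisors d) + size D)%N.
  rewrite -sum1_size -big_split; apply: eq_big_seq => d /=.
  rewrite mem_proper_divisors // => /andP[_ dvd_dn].
  by rewrite /s num_divisorsE ?addn1 // (dvdn_gt0 n_gt0 dvd_dn).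
have -> : s (label n) = (size D).+1 by exact: num_divisorsE.
(* With [s (label n) = size D + 1], the divisor sum equals the divisor-pair count plus
   [2 * size D + 1], which [- 2 * s (label n) + 1] cancels. The last factor becomes [size D - 1],
   absorbing the added [M.-1]. *)
nia.
Qed.
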